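(* Let $K$ be a separable metric space and let $f:K\to\mathbb{R}$ be a bounded function. (a) If $f\in SD(K)$, then $\lim_{\varepsilon\to0}\varepsilon\, i(f,\varepsilon)=0$. (b) If $f$ is semi-continuous (upper or lower) and $\lim_{\varepsilon\to0}\varepsilon\, i(f,\varepsilon)=0$, then $f\in SD(K)$.
   Context: Let $K$ be a (non-empty) separable metric space. $DBSC(K)$ is the set of all $f:K\to\mathbb{R}$ of the form $f=u-v$ with $u,v$ bounded lower semi-continuous on $K$; its members are called $D$-functions. Equivalently (Baire), $f\in DBSC(K)$ iff there is a sequence $(\varphi_j)$ of continuous real functions on $K$ with $\sup_{k\in K}\sum_j|\varphi_j(k)|<\infty$ and $f=\sum_j\varphi_j$ pointwise; $\|f\|_D$ denotes the infimum of $\sup_{k\in K}\sum_j|\varphi_j(k)|$ over all such sequences. $DBSC(K)$ with $\|\cdot\|_D$ is a Banach algebra. A simple $D$-function is a $D$-function taking only finitely many values. $SD(K)$ (the strong $D$-functions) is the set of $f:K\to\mathbb{R}$ for which there is a sequence $(\varphi_n)$ of simple $D$-functions on $K$ with $\|f-\varphi_n\|_D\to0$. For a bounded function $f$ on a metric space $L$, put $\underline{\mathrm{osc}}\,f(x)=\limsup_{y\to x}|f(y)-f(x)|$ and $\mathrm{osc}\,f(x)=\limsup_{y\to x}\underline{\mathrm{osc}}\,f(y)$, where limsups are non-exclusive ($y=x$ allowed), i.e. $\limsup_{y\to x}g(y)=\inf_U\sup_{y\in U}g(y)$ over open neighborhoods $U$ of $x$ in $L$. For bounded $f:K\to\mathbb{R}$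 and $\varepsilon>0$, let $\mathrm{os}_0(f,\varepsilon)=K$ and, inductively, $\mathrm{os}_{j+1}(f,\varepsilon)=\{x\in L:\mathrm{osc}(f|_L)(x)\ge\varepsilon\}$ where $L=\mathrm{os}_j(f,\varepsilon)$ (oscillation computed in the subspace $L$). Set $i(f,\varepsilon)=\sup\{n:\mathrm{os}_n(f,\varepsilon)\ne\emptyset\}\in\{0,1,2,\dots\}\cup\{\infty\}$. The limit is as $\varepsilon\to0$ through positive values. *)

(* Defs.v *)
From mathcomp Require Import all_boot all_order all_algebra.
From mathcomp Require Import all_classical all_reals all_analysis.

Set Implicit Arguments.
Unset Strict Implicit.
Unset Printing Implicit Defensive.

Import Order.TTheory GRing.Theory Num.Theory.
Import numFieldNormedType.Exports.

Local Open Scope classical_set_scope.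
Local Open Scope ring_scope.

Definition separable_space (T : topologicalType) :=
  exists D : set T, countable D /\ dense D.

(* Dual of the library's lower_semicontinuous. *)
Definition upper_semicontinuous (T : topologicalType) (R : realType)
    (f : T -> \bar R) :=
  forall x (a : R), (f x < a%:E)%E ->
    exists2 V, nbhs x V & forall y, V y -> (f y < a%:E)%E.

Section DFunctions.
Context {T : topologicalType} {R : realType}.
Implicit Types f : T -> R.

Definition DBSC : set (T -> R) :=
  [set f | exists u v : T -> R,
    [/\ bounded_fun u, bounded_fun v,
        lower_semicontinuous (EFin \o u), lower_semicontinuous (EFin \o v)
      & f = u \- v]].

Definition abs_sum_sup (phi : nat -> T -> R) : \bar R :=
  ereal_sup (range (fun k => \sum_(0 <= j <oo) `|phi j k|%:E)%E).

Definition D_representation f (phi : nat -> T -> R) :=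
  [/\ forall j, continuous (phi j),
      (abs_sum_sup phi < +oo)%E
    & forall k, \sum_(0 <= j < n) phi j k @[n --> \oo] --> f k].

(* As an infimum in \bar R, this is +oo exactly when f has no representation,
   that is, for T metrizable, when f is not in DBSC (Baire). *)
Definition D_norm f : \bar R :=
  ereal_inf [set abs_sum_sup phi | phi in D_representation f].

Definition simple_D : set (T -> R) :=
  [set f | DBSC f /\ finite_set (range f)].

Definition SD : set (T -> R) :=
  [set f | exists phi : nat -> T -> R,
    (forall n, simple_D (phi n)) /\
    D_norm (f \- phi n) @[n --> \oo] --> 0%E].

End DFunctions.

Section Oscillation.
Context {T : topologicalType} {R : realType}.
Implicit Types (f : T -> R) (L : set T).

(* For x in L, the non-exclusive superior limit at x of the restriction of g to
   the subspace L. The sets of the filter within L (nbhs x) may stick out of L,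
   which does not affect the infimum; see limsup_inE. *)
Definition limsup_in L (g : T -> \bar R) (x : T) : \bar R :=
  limf_esup g (within L (nbhs x)).

Lemma limsup_inE L g x :
  limsup_in L g x = ereal_inf [set ereal_sup (g @` (U `&` L)) |
                               U in [set U | open U /\ U x]].
Proof.
rewrite /limsup_in /limf_esup; apply/eqP; rewrite eq_le; apply/andP; split.
  apply: ereal_inf_le_tmp => _ [U [oU Ux] <-]; exists (U `&` L) => //.
  rewrite /within /=; apply: filterS (open_nbhs_nbhs (conj oU Ux)) => y Uy Ly.
  by split.
apply: le_ereal_inf_tmp => _ [V xV <-].
move: xV; rewrite /within /= nbhsE => -[U [oU Ux] UV].
apply: ge_ereal_inf; exists (ereal_sup (g @` (U `&` L))); first by exists U.
by apply: ereal_sup_le => _ [y [Uy Ly] <-]; exists y => //; exact: UV.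
Qed.

Definition lower_osc L f (x : T) : \bar R :=
  limsup_in L (fun y => `|f y - f x|%:E) x.

Definition osc L f (x : T) : \bar R := limsup_in L (lower_osc L f) x.

Fixpoint os f (eps : R) (n : nat) : set T :=
  if n is m.+1 then
    [set x | os f eps m x /\ (eps%:E <= osc (os f eps m) f x)%E]
  else setT.

Definition osc_index f (eps : R) : \bar R :=
  ereal_sup [set n%:R%:E | n in [set n | os f eps n !=set0]].

End Oscillation.

(* Main.v *)
Require Import Defs.
From mathcomp Require Import all_boot all_order all_algebra.
From mathcomp Require Import all_classical all_reals all_analysis.
From mathcomp Require Import ring lra.

Import Order.TTheory GRing.Theory Num.Theory.
Import numFieldNormedType.Exports.

Local Open Scope classical_set_scope.
Local Open Scope ring_scope.

(* (a) Call [w] a control of [g] if near every [y],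
   [|g z - g y| <= w z - w y + o(1)]: such are [u + v] for [g = u - v] and
   [sum |phi_j|] for [g = sum phi_j]. A point of the n-th oscillation set starts
   a chain of n jumps of [f] by nearly [eps], each of which raises the control,
   so that [n] is bounded by its oscillation. Writing [f] as a simple [D]-function
   plus one of norm [< delta], jumps of the simple part are bounded in number
   independently of [eps], the other ones by about [2 delta / eps].
   (b) Let [f] be lsc, [s >= f] a simple lsc step approximation within [eps],
   and [G] the upper envelope of [f] on the piece
   [os_j(f, eps) \ os_(j+1)(f, eps)] containing the point. Then
   [f - s = (f - G) - (s - G)], where on each piece both terms are lsc and at
   most [eps] in absolute value. Adding [2 eps (N - j)] to both on the j-th
   piece makes them lsc on [K] and of size [O(eps N)], where [N] is about
   [i(f, eps)]. *)

(** * Lower semicontinuity in epsilon form, and superior limits within a subset *)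

Lemma lower_semicontinuous_EFinP (R : realType) (T : topologicalType) (u : T -> R) :
  lower_semicontinuous (EFin \o u) <->
  forall x e, 0 < e -> \forall y \near x, u x - e < u y.
Proof.
split=> [lu x e e0|lu x a /=].
  have [|V xV uV] := lu x (u x - e); first by rewrite /= lte_fin ltrBlDr ltrDl.
  by apply: filterS xV => y /uV /=; rewrite lte_fin.
rewrite lte_fin -subr_gt0 => ax; have := lu x _ ax; rewrite subKr => au.
by exists [set y | a < u y] => // y; rewrite /= lte_fin.
Qed.

Section limsup.
Context (R : realType) (T : topologicalType).
Implicit Types (L : set T) (g : T -> \bar R).

Lemma limsup_in_gt L g x (c : \bar R) (V : set T) :
  (c < limsup_in L g x)%E -> nbhs x V -> exists y, [/\ V y, L y & (c < g y)%E].
Proof.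
move=> cg xV; apply: contrapT => nex; move: cg; apply/negP; rewrite -leNgt.
apply: ereal_inf_le; exists (ereal_sup (g @` (V `&` L))).
  exists (V `&` L) => //; rewrite /within /=.
  by apply: filterS xV => y Vy Ly; split.
apply: ge_ereal_sup => _ [y [Vy Ly] <-]; rewrite leNgt; apply/negP => cy.
by apply: nex; exists y.
Qed.

Lemma limsup_in_lt L g x (c : \bar R) :
  (limsup_in L g x < c)%E ->
  exists2 d, (d < c)%E & \forall y \near x, L y -> (g y <= d)%E.
Proof.
move=> /ereal_inf_lt[_ [V xV <-] Vc]; exists (ereal_sup (g @` V)) => //.
apply: filterS xV => y Vy; apply: ereal_sup_ubound; by exists y.
Qed.

Lemma limsup_in_le L g x (c : \bar R) :
  (\forall y \near x, L y -> (g y <= c)%E) -> (limsup_in L g x <= c)%E.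
Proof.
move=> gc; apply: ereal_inf_le; exists (ereal_sup (g @` [set y | (g y <= c)%E])).
  by exists [set y | (g y <= c)%E].
by apply: ge_ereal_sup => _ [y + <-].
Qed.

End limsup.

(** * Controls of a function and chains of jumps *)

Section control.
Context (R : realType) (T : topologicalType).
Implicit Types (f g u v w : T -> R).

Definition controls w g :=
  forall y e, 0 < e -> \forall z \near y, `|g z - g y| <= w z - w y + e.

(** The increments [a] of [u] and [b] of [v] are nearly nonnegative near [y], and
    [|a - b| = a + b - 2 min(a, b)]. *)
Lemma controls_DBSC u v :
  lower_semicontinuous (EFin \o u) -> lower_semicontinuous (EFin \o v) ->
  controls (u \+ v) (u \- v).
Proof.
move=> /lower_semicontinuous_EFinP lu /lower_semicontinuous_EFinP lv y e e0.
have e4 : 0 < e / 4 by rewrite divr_gt0.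
near=> z.
have uz : u y - e / 4 < u z by near: z; exact: lu.
have vz : v y - e / 4 < v z by near: z; exact: lv.
rewrite /= ler_norml; lra.
Unshelve. all: by end_near. Qed.

(** The control is [w = sum |phi j|]. Since [|g - S N| <= w - A N] everywhere and the partial sums
    [S N], [A N] are continuous, an [N] with a small tail of [w] at [y] gives the estimate near
    [y]. *)
Lemma controls_series g (phi : nat -> T -> R) (M : R) :
  D_representation g phi -> (abs_sum_sup phi <= M%:E)%E ->
  exists w, controls w g /\ forall x, 0 <= w x <= M.
Proof.
move=> [cphi _ phig] phiM.
pose S N x := \sum_(0 <= j < N) phi j x.
pose A N x := \sum_(0 <= j < N) `|phi j x|.
have AM N x : A N x <= M.
  rewrite -lee_fin; apply: le_trans phiM.
  rewrite /A -sumEFin; apply: (@le_trans _ _ (\sum_(0 <= j <oo) `|phi j x|%:E)%E).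
    by apply: nneseries_lim_ge => n _ _; rewrite lee_fin.
  by apply: ereal_sup_ubound; exists x.
pose w x := sup (range (A ^~ x)).
have supA x : has_sup (range (A ^~ x)).
  by split; [exists (A 0 x), 0%N | exists M => _ [n _ <-]].
have Aw N x : A N x <= w x by apply: ub_le_sup; [case: (supA x)|exists N].
have tail N x : `|g x - S N x| <= w x - A N x.
  have cS : (fun n => `|S n x - S N x|) @ \oo --> `|g x - S N x|.
    apply: cvg_norm; apply: cvgB; [exact: phig|exact: cvg_cst].
  rewrite -(cvg_lim _ cS)//; apply: limr_le; first by apply/cvg_ex; eexists; exact: cS.
  near=> n; have Nn : (N <= n)%N by near: n; exact: nbhs_infty_ge.
  rewrite /S (@big_cat_nat _ _ _ N)//= addrAC subrr add0r.
  apply: le_trans (ler_norm_sum _ _ _) _.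
  by have := Aw n x; rewrite /A (@big_cat_nat _ _ _ N)//= lerBrDl.
have csum (F : nat -> T -> R) N : (forall j, continuous (F j)) ->
    continuous (fun x => \sum_(0 <= j < N) F j x).
  by move=> cF; apply: continuous_big => [|j _]; [exact: add_continuous|exact: cF].
exists w; split=> [y e e0|x]; last first.
  apply/andP; split; first by apply: le_trans (Aw 0%N x); rewrite /A big_geq.
  by apply: ge_sup => [|_ [n _ <-]]; first by exists (A 0%N x), 0%N.
have e4 : 0 < e / 4 by rewrite divr_gt0.
have [_ [N _ <-] wN] := sup_adherent e4 (supA y).
rewrite -/(w y) in wN.
near=> z.
have Sz : `|S N y - S N z| < e / 4.
  by near: z; apply: (cvgrPdist_lt _ _).1 e4; exact: csum.
have Az : `|A N y - A N z| < e / 4.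
  near: z; apply: (cvgrPdist_lt _ _).1 e4; apply: csum => j t.
  by apply: cvg_norm; exact: cphi.
have := tail N y; have := tail N z; have := Aw N z.
move: Sz Az; rewrite !ltr_norml !ler_norml; lra.
Unshelve. all: by end_near. Qed.

(** [W] is normalized so that each jump by more than [eps / 2] raises it by almost [1]. Along a
    chain of [n] jumps it rises by almost [n], within its oscillation bound [B]. *)
Lemma os_chain f (eps : R) (W : T -> R) (B : R) :
  0 < eps -> (forall x y, W x - W y <= B) ->
  (forall y e, 0 < e -> \forall z \near y, W y - e <= W z) ->
  (forall y e, 0 < e -> \forall z \near y, eps / 2 < `|f z - f y| -> W y + 1 - e <= W z) ->
  forall n, os f eps n !=set0 -> n%:R <= B.
Proof.
move=> eps0 WB Wlsc Wjump n [x osx]; apply/ler_addgt0Pr => e e0.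
suff [y Wy] : exists y, W x + n%:R - e <= W y by have := WB y x; lra.
elim: n x e e0 osx => [|n IH] x e e0 /= => [_|[xL oscx]].
  by exists x; lra.
have e3 : 0 < e / 3 by lra.
have eps2 : ((eps / 2)%:E < osc (os f eps n) f x)%E.
  by apply: lt_le_trans oscx; rewrite lte_fin; lra.
(* [osc] is a limsup of limsups: the outer one moves [x] to some [y] at almost no loss of [W], the
   inner one moves [y] to some [z] at which [f] jumps. *)
have [y [/= Wy yL ly]] := limsup_in_gt _ _ _ _ _ _ _ eps2 (Wlsc x _ e3).
have [z [/= Wz zL]] := limsup_in_gt _ _ _ _ _ _ _ ly (Wjump y _ e3).
rewrite lte_fin => /Wz {}Wz.
have [t Wt] := IH z _ e3 zL.
by exists t; rewrite -natr1; lra.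
Qed.

End control.

Lemma finite_range_gap (R : realType) (T : Type) (s : T -> R) : finite_set (range s) ->
  exists2 d : R, 0 < d & forall x y, s x != s y -> d <= `|s x - s y|.
Proof.
move=> /finite_seqP[l ls].
(* The default [1] keeps the gap positive when [s] has at most one value. *)
exists (\big[Num.min/1]_(p <- [seq (a, b) | a <- l, b <- l] | p.1 != p.2) `|p.1 - p.2|).
  elim/big_ind: _ => // [a b a0 b0|p]; first by rewrite lt_min a0.
  by rewrite normr_gt0 subr_eq0.
move=> x y sxy.
have inl t : s t \in l by have : [set` l] (s t) by rewrite -ls; exists t.
apply: (@ge_bigmin_seq _ _ _ _ _ (s x, s y)) => //.
by apply: allpairs_f.
Qed.

(** * Oscillation sets: closedness, rank of a point, envelopes on the pieces *)

Section os_structure.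
Context (R : realType) (T : topologicalType) (f : T -> R) (eps : R).

(** The oscillation sets are closed: a bound on [lower_osc] near [x] holds near every [y] near [x],
    hence bounds [osc] there. *)
Lemma osN_near n x : ~ os f eps n x -> \forall y \near x, ~ os f eps n y.
Proof.
elim: n x => [|n IH] x /= nx; first by exfalso; exact: nx.
have [xn|/IH] := pselect (os f eps n x); last first.
  by apply: filterS => y ny [].
have /limsup_in_lt[d deps] : (osc (os f eps n) f x < eps%:E)%E.
  by rewrite ltNge; apply/negP => ?; exact: nx.
move=> /near_join; apply: filterS => y yd [_]; apply/negP; rewrite -ltNge.
by apply: le_lt_trans deps; exact: limsup_in_le.
Qed.

Lemma os_le m n : (m <= n)%N -> os f eps n `<=` os f eps m.
Proof.
by move=> /subnKC <-; elim: (n - m)%N => [|k IH]; rewrite ?addn0 ?addnS // => x /= [/IH].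
Qed.

Lemma os_rank N : os f eps N = set0 ->
  exists r : T -> nat, forall x, [/\ (r x < N)%N, os f eps (r x) x & ~ os f eps (r x).+1 x].
Proof.
move=> osN; suff H x : exists j, [/\ (j < N)%N, os f eps j x & ~ os f eps j.+1 x].
  by have [r rP] := choice H; exists r.
have : ~ os f eps N x by rewrite osN.
elim: N {osN} => [|N IH] nx; first by exfalso; exact: nx.
have [xN|/IH[j [jN ? ?]]] := pselect (os f eps N x); first by exists N.
by exists j; split=> //; exact: ltnW.
Qed.

(** [G] is the limsup of [f] within [L] at [x], finite because it lies between [f x] and [M]. *)
Lemma upper_envelope (L : set T) (M : R) x : L x -> (forall y, f y <= M) ->
  exists G, (forall e, 0 < e -> \forall y \near x, L y -> f y < G + e) /\
            (forall c, (\forall y \near x, L y -> f y <= c) -> G <= c).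
Proof.
move=> Lx fM; set l := limsup_in L (EFin \o f) x.
have lM : (l <= M%:E)%E by apply: limsup_in_le; apply: nearW => y _; rewrite lee_fin.
have fl : ((f x)%:E <= l)%E.
  apply: le_ereal_inf_tmp => _ [V /nbhs_singleton xV <-].
  by apply: ereal_sup_ubound; exists x => //; exact: xV.
have lfin : l \is a fin_num.
  rewrite fin_numE; apply/andP; split; apply/eqP => lE; move: lM fl; rewrite lE.
    by rewrite leeNy_eq.
  by rewrite leye_eq.
exists (fine l); split=> [e e0|c fc]; last first.
  by rewrite -lee_fin fineK//; apply: limsup_in_le; apply: filterS fc => y yc /yc.
have /limsup_in_lt[d dl] : (l < (fine l + e)%:E)%E by rewrite EFinD fineK// lteDl// lte_fin.
by apply: filterS => y yd /yd; move: dl => /[swap] /le_lt_trans /[apply]; rewrite lte_fin.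
Qed.

(* On [L = os_j \ os_(j+1)] the upper envelope [G] of [f|L] satisfies
   [f <= G <= f + eps]; adding [2 eps (N - j)] makes [p - G], for [p] lsc and
   [eps]-close to [G], jump in the right direction between different pieces. *)
Lemma envelope_gluing (M : R) N : 0 < eps -> (forall y, f y <= M) -> os f eps N = set0 ->
  exists (r : T -> nat) (G : T -> R),
    [/\ forall x, (r x < N)%N, forall x, f x <= G x <= f x + eps &
     forall p : T -> R, lower_semicontinuous (EFin \o p) ->
       (forall x, `|p x - G x| <= eps) ->
       lower_semicontinuous (EFin \o (fun x => p x - G x + 2 * eps * (N - r x)%:R))].
Proof.
move=> eps0 fM osN; have [r rP] := os_rank _ osN.
(* The envelope is taken within [os f eps (r x)]; at [x] this agrees with the envelope on the piece,
   since the next oscillation set is closed and misses [x]. *)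
have [G GP] := choice (fun x => let: And3 _ xr _ := rP x in upper_envelope _ _ _ xr fM).
exists r, G; split=> [x|x|p lp pG].
- by case: (rP x).
- have [G1 G2] := GP x; have [_ xr nxr] := rP x.
  apply/andP; split.
    by apply/ler_addgt0Pr => e /G1/nbhs_singleton/(_ xr)/ltW.
  have /limsup_in_lt[d deps] : (osc (os f eps (r x)) f x < eps%:E)%E.
    by rewrite ltNge; apply/negP => ?; exact: nxr.
  (* As limsups are non-exclusive, [osc] at [x] dominates [lower_osc] at [x]. *)
  move=> /nbhs_singleton/(_ xr) xd.
  have /limsup_in_lt[c ceps fc] := le_lt_trans xd deps.
  apply: G2; apply: filterS fc => y yc /yc {}yc.
  have := le_lt_trans yc ceps; rewrite lte_fin => /ltW; rewrite ler_norml; lra.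
apply/lower_semicontinuous_EFinP => x e e0.
have [G1 _] := GP x; have [xN xr nxr] := rP x.
have e2 : 0 < e / 2 by lra.
(* The bound on [f] holds near each [y] near [x], which makes [G] upper semicontinuous along points
   of equal rank. *)
have /near_join Gnear := G1 _ e2.
near=> y.
have [_ G2] := GP y; have [yN yr nyr] := rP y.
have nyx : ~ os f eps (r x).+1 y by near: y; exact: osN_near.
have ryx : (r y <= r x)%N.
  by rewrite leqNgt; apply/negP => xy; apply: nyx; exact: os_le yr.
have py : p x - e / 2 < p y.
  by near: y; move: lp => /lower_semicontinuous_EFinP; exact.
have [ryrx|rynx] := eqVneq (r y) (r x).
  have : G y <= G x + e / 2.
    apply: G2; rewrite ryrx; near: y; apply: filterS Gnear => y.
    by apply: filterS => z zG /zG/ltW.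
  by rewrite ryrx; lra.
(* Near [x] the rank can only drop. A drop adds at least [2 * eps], which outweighs the change of
   [p - G], at most [eps] in absolute value at both points. *)
have : (N - r x)%:R + 1 <= (N - r y)%:R :> R.
  by rewrite natr1 ler_nat ltn_sub2l// ltn_neqAle rynx.
have := pG x; have := pG y; rewrite !ler_norml => /andP[y1 _] /andP[_ x2].
rewrite -(ler_pM2l (_ : 0 < 2 * eps)); last by lra.
lra.
Unshelve. all: by end_near. Qed.

End os_structure.

(** * Approximation from above by simple lower semicontinuous functions *)

Section step_approximation.
Context (R : realType) (T : topologicalType).

(** Rounding up to multiples of [eps] preserves lower semicontinuity, because the ceiling is
    nondecreasing and left-continuous. *)
Lemma step_approx (f : T -> R) (eps M : R) : 0 < eps ->
  (forall x, `|f x| <= M) -> lower_semicontinuous (EFin \o f) ->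
  exists s : T -> R, [/\ simple_D s, lower_semicontinuous (EFin \o s) &
    forall x, f x <= s x <= f x + eps].
Proof.
move=> eps0 fM /lower_semicontinuous_EFinP lf.
pose s x := eps * (Num.ceil (f x / eps))%:~R.
have sf x : f x <= s x <= f x + eps.
  have := ceil_itv (f x / eps); rewrite intrB => /andP[c1 c2].
  apply/andP; split.
    by rewrite /s mulrC -ler_pdivrMr.
  have : ((Num.ceil (f x / eps))%:~R - 1) * eps < f x by rewrite -ltr_pdivlMr.
  by rewrite /s; lra.
have ls : lower_semicontinuous (EFin \o s).
  apply/lower_semicontinuous_EFinP => x e e0.
  pose c := Num.ceil (f x / eps).
  have cx : (c - 1)%:~R * eps < f x.
    by rewrite -ltr_pdivlMr//; case/andP: (ceil_itv (f x / eps)).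
  have e1 : 0 < f x - (c - 1)%:~R * eps by rewrite subr_gt0.
  apply: filterS (lf x _ e1) => y; rewrite subKr -ltr_pdivlMr// -ceil_gt_int => cy.
  have : c <= Num.ceil (f y / eps) by rewrite -(subrK 1 c) lezD1.
  rewrite -(ler_int R) -(ler_pM2l eps0) => cs.
  by rewrite ltrBlDr; apply: le_lt_trans cs _; rewrite ltrDl.
have sM x : `|s x| <= M + eps.
  by have := sf x; have := fM x; rewrite !ler_norml; lra.
exists s; split=> //; split.
  exists s, (cst 0); split=> //.
  - by exists (M + eps); split; rewrite ?num_real// => t Mt x _; apply: le_trans (sM x) (ltW Mt).
  - by exists 0; split => // t Mt x _ /=; rewrite normr0 ltW.
  - by apply/lower_semicontinuous_EFinP => x e e0; apply: nearW => y; rewrite /cst; lra.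
  - by apply/funext => x /=; rewrite subr0.
have [n nM] : exists n : nat, (M + eps) / eps < n%:R.
  by exists (Num.trunc ((M + eps) / eps)).+1; exact: truncnS_gt.
pose F (a : R) (i : nat) := a * i%:R.
apply: (@sub_finite_set _ _ (F eps @` `I_n `|` F (- eps) @` `I_n)).
  move=> _ [x _ <-]; rewrite /s.
  set c := Num.ceil _.
  have cn : (`|c|%N < n)%N.
    rewrite -(ltr_nat R); apply: le_lt_trans nM.
    rewrite ler_pdivlMr// natr_absz intr_norm mulrC.
    by have := sM x; rewrite /s normrM (gtr0_norm eps0).
  have [c0|c0] := leP 0 c; [left|right]; exists `|c|%N => //.
    by rewrite /F natr_absz ger0_norm.
  by rewrite /F natr_absz ltr0_norm// mulrNz mulrNN.
by rewrite finite_setU; split; apply: finite_image; exact: finite_II.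
Qed.
End step_approximation.

(** * Baire approximation and an upper bound for the D-norm *)

Section baire.
Context (R : realType) (K : metricType R).
Implicit Types u v f : K -> R.

Lemma lsc_cvg_continuous u (B : R) :
  lower_semicontinuous (EFin \o u) -> (forall x, 0 <= u x <= B) ->
  exists U : nat -> K -> R,
    [/\ forall n, continuous (U n), forall x, U 0%N x = 0,
        forall n x, U n x <= U n.+1 x, forall n x, U n x <= u x &
        forall x, U n x @[n --> \oo] --> u x].
Proof.
move=> /lower_semicontinuous_EFinP lu uB.
have u0 x : 0 <= u x by case/andP: (uB x).
pose A n x := [set u y + n%:R * mdist x y | y in [set: K]].
have A0 n x : lbound (A n x) 0.
  by move=> _ [y _ <-]; rewrite addr_ge0// mulr_ge0// mdist_ge0.
have infA n x : has_inf (A n x) by split; [exists (u x + n%:R * mdist x x), x|exists 0].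
(* For [n > 0] this is the [n]-Lipschitz regularization of [u]. The value [0] at [n = 0] lets the
   increments telescope to [U n]. *)
pose U n x := if n is 0%N then 0 else inf (A n x).
have UA n x y : U n x <= u y + n%:R * mdist x y.
  case: n => [|n]; first by rewrite addr_ge0// mul0r.
  by apply: ge_inf; [case: (infA n.+1 x)|exists y].
have AU n x c : (forall y, c <= u y + n.+1%:R * mdist x y) -> c <= U n.+1 x.
  move=> h; apply: lb_le_inf; first by case: (infA n.+1 x).
  by move=> _ [y _ <-].
have Uu n x : U n x <= u x by have := UA n x x; rewrite mdistxx mulr0 addr0.
exists U; split=> // [n x|n x|x].
- case: n => [|n]; first exact: cst_continuous.
  have lip y z : U n.+1 y <= U n.+1 z + n.+1%:R * mdist y z.
    rewrite -lerBlDr; apply: AU => t; rewrite lerBlDr.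
    apply: le_trans (UA _ _ t) _; rewrite -addrA lerD2l -mulrDr ler_wpM2l//.
    by rewrite addrC metric_triangle.
  apply/cvgrPdist_lt => e e0.
  have : \forall y \near x, mdist x y < e / n.+1%:R.
    apply/nbhs_ballP; exists (e / n.+1%:R); first by rewrite /= divr_gt0.
    by rewrite ballEmdist.
  apply: filterS => y; rewrite ltr_pdivlMr// mulrC => xy.
  rewrite ltr_norml; have := lip x y; have := lip y x; rewrite (metric_sym y x); lra.
- apply: AU => y; case: n => [|n]; first by rewrite addr_ge0// mulr_ge0// mdist_ge0.
  by apply: le_trans (UA _ _ y) _; rewrite lerD2l ler_wpM2r// ?mdist_ge0// ler_nat.
apply/cvgrPdist_le => e e0.
have [r /= r0 rP] : exists2 r : R, 0 < r & forall y, mdist x y < r -> u x - e < u y.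
  have /nbhs_ballP[r /= r0 rP] := lu x e e0; exists r => // y xy.
  by apply: rP; rewrite ballEmdist.
near=> n.
(* In the infimum, points at distance at least [r] cost more than [B >= u x], and closer ones have
   [u y > u x - e]. *)
have nB : B < n%:R * r.
  by rewrite -ltr_pdivrMr//; near: n; exact: nbhs_infty_gtr.
have n0 : (0 < n)%N by near: n; exact: nbhs_infty_gt.
rewrite ger0_norm ?subr_ge0// lerBlDl -lerBlDr.
have -> : n = n.-1.+1 by rewrite prednK.
apply: AU => y; rewrite prednK//.
have [/rP uy|ry] := ltP (mdist x y) r.
  by apply: le_trans (ltW uy) _; rewrite lerDl mulr_ge0// mdist_ge0.
have : n%:R * r <= n%:R * mdist x y by rewrite ler_wpM2l.
have := uB x; have := u0 y; lra.
Unshelve. all: by end_near. Qed.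

(** The representation consists of the increments of the approximations of [u] minus those of [v].
    Each family is nonnegative and telescopes to at most [B]. *)
Lemma D_norm_le u v (B : R) :
  lower_semicontinuous (EFin \o u) -> lower_semicontinuous (EFin \o v) ->
  (forall x, 0 <= u x <= B) -> (forall x, 0 <= v x <= B) ->
  (D_norm (u \- v)%R <= (B + B)%:E)%E.
Proof.
move=> lu lv uB vB.
have [U [cU U0 Uhomo Uu Ucvg]] := lsc_cvg_continuous _ _ lu uB.
have [V [cV V0 Vhomo Vv Vcvg]] := lsc_cvg_continuous _ _ lv vB.
pose phi j x := (U j.+1 x - U j x) - (V j.+1 x - V j x).
have phiB : (abs_sum_sup phi <= (B + B)%:E)%E.
  apply: ge_ereal_sup => _ [x _ <-].
  apply: lime_le; first by apply: is_cvg_nneseries => n _ _; rewrite lee_fin.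
  apply: nearW => n; rewrite sumEFin lee_fin.
  apply: (@le_trans _ _ (\sum_(0 <= j < n) ((U j.+1 x - U j x) + (V j.+1 x - V j x)))).
    apply: ler_sum => j _; apply: le_trans (ler_normB _ _) _.
    by rewrite !ger0_norm// subr_ge0.
  rewrite big_split/= !telescope_sumr// U0 V0 !subr0 lerD//.
    by apply: le_trans (Uu _ _) _; case/andP: (uB x).
  by apply: le_trans (Vv _ _) _; case/andP: (vB x).
apply: ereal_inf_le; exists (abs_sum_sup phi) => //; exists phi => //; split.
- move=> j x; apply: cvgB; apply: cvgB; (exact: cU || exact: cV).
- by apply: le_lt_trans phiB _; rewrite ltry.
- move=> x; rewrite (_ : (fun n => _) = (fun n => U n x - V n x)).
    by apply: cvgB; [exact: Ucvg|exact: Vcvg].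
  by apply/funext => n; rewrite sumrB !telescope_sumr// U0 V0 !subr0.
Qed.

End baire.

(** The D-norms and [eps] times the index may be infinite; for nonnegative values convergence to [0]
    reduces to eventual real upper bounds. *)
Lemma near_ge0_cvg0eP (R : realType) (T : Type) (F : set_system T) {FF : Filter F}
    (g : T -> \bar R) :
  (\forall x \near F, (0 <= g x)%E) ->
  (g @ F --> (0 : \bar R)%E) <->
  (forall d : R, 0 < d -> \forall x \near F, (g x < d%:E)%E).
Proof.
move=> g0; split=> [gF d d0|gF].
  apply: (gF [set y | (y < d%:E)%E]); apply: open_nbhs_nbhs.
  by split; [exact: open_ereal_lt_ereal|rewrite /= lte_fin].
have fin d x : (0 <= g x)%E -> (g x < d%:E)%E -> g x \is a fin_num.
  by move=> gx0 gx; rewrite ge0_fin_numE//; apply: lt_trans gx _; rewrite ltry.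
apply/fine_cvgP; split; first by apply: filterS2 g0 (gF 1 ltr01) => x; exact: fin.
apply/cvgrPdist_lt => e e0; apply: filterS2 g0 (gF e e0) => x gx0 gx /=.
by rewrite sub0r normrN ger0_norm ?fine_ge0// -lte_fin fineK// (fin e).
Qed.

(** * Part (a): the index of a strong D-function *)

Section index.
Context (R : realType) (T : topologicalType).
Implicit Types f s : T -> R.

Lemma osc_index_ub f eps n : os f eps n !=set0 -> (n%:R%:E <= osc_index f eps)%E.
Proof. by move=> osn; apply: ereal_sup_ubound; exists n. Qed.

Lemma os_opp f eps : os (\- f) eps = os f eps.
Proof.
have lo L : lower_osc L (\- f) = lower_osc L f.
  apply/funext => x; congr (limsup_in L _ x); apply/funext => y /=.
  by rewrite -opprD normrN.
apply/funext; elim=> //= n ->; apply/seteqP.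
by split=> x [?]; rewrite /osc lo.
Qed.

Lemma osc_index_opp f eps : osc_index (\- f) eps = osc_index f eps.
Proof. by rewrite /osc_index os_opp. Qed.

Lemma simple_D_opp s : simple_D s -> simple_D (\- s).
Proof.
move=> [[u [v [bu bv lu lv suv]]] fs]; split.
  by exists v, u; split=> //; rewrite suv; apply/funext => x /=; rewrite opprB.
rewrite (_ : range _ = -%R @` range s); first exact: finite_image.
by rewrite image_comp.
Qed.

Lemma bounded_funP f : bounded_fun f -> exists M : R, forall x, `|f x| <= M.
Proof.
move=> [M [_ Mf]]; exists (M + 1) => x.
by apply: (Mf (M + 1)) => //; rewrite ltrDl.
Qed.

Lemma abs_sum_sup_ge0 (phi : nat -> T -> R) : [set: T] !=set0 ->
  (0 <= abs_sum_sup phi)%E.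
Proof.
move=> [x _]; apply: ereal_sup_ge; exists (\sum_(0 <= j <oo) `|phi j x|%:E)%E; first by exists x.
by apply: nneseries_ge0 => n _ _; rewrite lee_fin.
Qed.

Lemma D_norm_ge0 f : [set: T] !=set0 -> (0 <= D_norm f)%E.
Proof.
by move=> T0; apply: le_ereal_inf_tmp => _ [phi _ <-]; exact: abs_sum_sup_ge0.
Qed.

Lemma osc_index_ge0 f eps : [set: T] !=set0 -> (0 <= osc_index f eps)%E.
Proof. exact: (@osc_index_ub f eps 0%N). Qed.

(* With [w] controlling the simple part and [w'] the [D]-small part, a jump of
   [f] by more than [eps / 2] raises [w / d + (2 / eps) w'] by almost [1]: either
   the simple part jumps, by at least its gap [d], or the small part does. *)
Lemma SD_osc_index_lt f : [set: T] !=set0 -> SD f ->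
  forall delta, 0 < delta ->
    \forall eps \near (0 : R)^'+, (eps%:E * osc_index f eps < delta%:E)%E.
Proof.
move=> T0 [phi [simphi phicvg]] delta delta0.
have M0 : 0 < delta / 4 by lra.
have [n Dn] : exists n, (D_norm (f \- phi n)%R < (delta / 4)%:E)%E.
  have Dge0 : \forall n \near \oo, (0 <= D_norm (f \- phi n)%R)%E.
    by apply: nearW => n; exact: D_norm_ge0.
  exact: filter_ex (proj1 (near_ge0_cvg0eP _ _ _ _ Dge0) phicvg _ M0).
have [_ [psi psig <-] /ltW psiM] := ereal_inf_lt Dn.
have [w' [cw' w'M]] := controls_series _ _ _ _ _ psig psiM.
have [[u [v [/bounded_funP[Mu uM] /bounded_funP[Mv vM] lu lv suv]]]] := simphi n.
move=> /finite_range_gap[d d0 gap].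
have := controls_DBSC _ _ _ _ lu lv; rewrite -suv; set w := u \+ v => cw.
pose C := 2 * (Mu + Mv).
have wC x y : w x - w y <= C.
  have := uM x; have := uM y; have := vM x; have := vM y.
  by rewrite !ler_norml /w /C /=; lra.
have C0 : 0 <= C by case: T0 => x _; have := wC x x; lra.
have Cd0 : 0 < C / d + 1 by rewrite ltr_wpDl// divr_ge0// ltW.
near=> eps.
have eps0 : 0 < eps by near: eps; exact: nbhs_right_gt.
have epsC : eps * (C / d + 1) < delta / 4.
  by rewrite -ltr_pdivlMr//; near: eps; apply: nbhs_right_lt; rewrite divr_gt0.
pose W x := w x / d + (2 / eps) * w' x.
pose B := C / d + (2 / eps) * (delta / 4).
have dV : 0 < d^-1 by rewrite invr_gt0.
have eV : 0 < 2 / eps by rewrite divr_gt0.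
have WB x y : W x - W y <= B.
  have : (w x - w y) * d^-1 <= C * d^-1 by rewrite ler_pM2r.
  have : (2 / eps) * (w' x - w' y) <= (2 / eps) * (delta / 4).
    by rewrite ler_pM2l//; have := w'M x; have := w'M y; lra.
  by rewrite /W /B; lra.
(* [S] is the total weight in [W], so an error [e / S] in each control costs [e] in [W]. *)
pose S := d^-1 + 2 / eps.
have S0 : 0 < S by rewrite addr_gt0.
have Wnear y e : 0 < e -> \forall z \near y, W y - e <= W z /\
    (eps / 2 < `|f z - f y| -> W y + 1 - e <= W z).
  move=> e0; have eS0 : 0 < e / S by rewrite divr_gt0.
  near=> z.
  have wz : `|phi n z - phi n y| <= w z - w y + e / S by near: z; exact: cw.
  have wz' : `|(f \- phi n) z - (f \- phi n) y| <= w' z - w' y + e / S by near: z; exact: cw'.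
  (* Weighted sum of the two control estimates, with [a] and [b] lower bounds for the jumps of the
     simple and the small part. *)
  have key a b : a <= w z - w y + e / S -> b <= w' z - w' y + e / S ->
      a / d + 2 / eps * b <= W z - W y + e.
    move=> aw bw; have : a * d^-1 <= (w z - w y + e / S) * d^-1 by rewrite ler_pM2r.
    have : 2 / eps * b <= 2 / eps * (w' z - w' y + e / S) by rewrite ler_pM2l.
    have : S * (e / S) = e by rewrite mulrC divfK// gt_eqF.
    by rewrite {1}/S /W; lra.
  split.
    have := key 0 0 (le_trans (normr_ge0 _) wz) (le_trans (normr_ge0 _) wz'); lra.
  move=> fzy; have [szy|/gap dzy] := eqVneq (phi n z) (phi n y).
    have fz : eps / 2 <= w' z - w' y + e / S.
      apply: le_trans wz'; apply: ltW; rewrite /= szy.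
      by rewrite (_ : _ - _ = f z - f y)//; lra.
    have := key 0 _ (le_trans (normr_ge0 _) wz) fz.
    rewrite (_ : 2 / eps * (eps / 2) = 1); first lra.
    by field; rewrite gt_eqF.
  have := key d 0 (le_trans dzy wz) (le_trans (normr_ge0 _) wz').
  by rewrite divff ?gt_eqF//; lra.
have nB m : os f eps m !=set0 -> m%:R <= B.
  apply: (os_chain _ _ _ _ _ _ eps0 WB) => y e e0.
    by apply: filterS (Wnear y e e0) => z [].
  by apply: filterS (Wnear y e e0) => z [].
have : (osc_index f eps <= B%:E)%E.
  by apply: ge_ereal_sup => _ [m /nB mB <-]; rewrite lee_fin.
move=> /(lee_wpmul2l (ltW (eps0 : (0 < eps%:E)%E))) /le_lt_trans; apply.
(* The simple part contributes [eps * C / d < delta / 4], the small part exactly [delta / 2]. *)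
rewrite -EFinM lte_fin /B mulrDr.
rewrite (_ : eps * (2 / eps * (delta / 4)) = delta / 2).
  by lra.
by field; rewrite gt_eqF.
Unshelve. all: by end_near. Qed.

End index.

(** * Part (b): approximation of a semicontinuous function by simple D-functions *)

Section SD_of_index.
Context (R : realType) (K : metricType R).
Implicit Types f : K -> R.

Lemma lsc_simple_approx f (delta : R) : bounded_fun f ->
  lower_semicontinuous (EFin \o f) ->
  (forall d : R, 0 < d -> \forall eps \near (0 : R)^'+, (eps%:E * osc_index f eps < d%:E)%E) ->
  0 < delta ->
  exists s u v : K -> R, [/\ simple_D s,
    lower_semicontinuous (EFin \o u) /\ (forall x, 0 <= u x <= delta),
    lower_semicontinuous (EFin \o v) /\ (forall x, 0 <= v x <= delta) &
    f \- s = u \- v].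
Proof.
move=> /bounded_funP[M fM] lf idx delta0.
have d0 : 0 < delta / 6 by lra.
have [eps [eps0 epsd epsi]] : exists eps : R, [/\ 0 < eps, eps < delta / 6 &
    (eps%:E * osc_index f eps < (delta / 6)%:E)%E].
  apply: (@filter_ex _ (0 : R)^'+); near=> eps; split; near: eps;
    [exact: nbhs_right_gt|exact: nbhs_right_lt|exact: idx].
set a := delta / 6 in d0 epsd epsi.
have a0 : 0 <= a / eps by rewrite divr_ge0// ltW.
(* [N] exceeds [a / eps], hence the index, but [eps * N <= a + eps]. The glued functions are then at
   most [eps + 2 * (a + eps) < 5 * a < delta]. *)
pose N := (Num.trunc (a / eps)).+1.
have /andP[] := truncn_itv a0; rewrite -/N => N1 N2.
have osN : os f eps N = set0.
  apply/eqP; rewrite -[_ == _]negbK; apply/negP => /set0P/osc_index_ub.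
  move=> /(lee_wpmul2l (ltW (eps0 : (0 < eps%:E)%E))) /le_lt_trans/(_ epsi).
  by rewrite -EFinM lte_fin mulrC -ltr_pdivlMr// => /(lt_trans N2); rewrite ltxx.
have epsN : eps * N%:R <= a + eps.
  by rewrite /N -natr1 mulrDr mulr1 lerD2r mulrC -ler_pdivlMr.
have fM' y : f y <= M by apply: le_trans (ler_norm _) (fM y).
have [r [G [rN fG glue]]] := envelope_gluing _ _ _ _ _ _ eps0 fM' osN.
have [s [sD ls sf]] := step_approx _ _ _ _ _ eps0 fM lf.
have rbnd p : (forall x, `|p x - G x| <= eps) ->
    forall x, 0 <= p x - G x + 2 * eps * (N - r x)%:R <= delta.
  move=> pG x; have := pG x; rewrite ler_norml.
  (* Since [r x < N], the added term is at least [2 * eps], whence nonnegativity. *)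
  have : eps * 1 <= eps * (N - r x)%:R by rewrite ler_pM2l// ler1n subn_gt0.
  have : eps * (N - r x)%:R <= eps * N%:R by rewrite ler_pM2l// ler_nat leq_subr.
  by rewrite /a in epsN epsd *; lra.
have fGe x : `|f x - G x| <= eps by have := fG x; rewrite ler_norml; lra.
(* Both [s] and [G] lie between [f] and [f + eps]. *)
have sGe x : `|s x - G x| <= eps by have := fG x; have := sf x; rewrite ler_norml; lra.
exists s, (fun x => f x - G x + 2 * eps * (N - r x)%:R),
  (fun x => s x - G x + 2 * eps * (N - r x)%:R).
split=> //; [by split; [exact: glue|exact: rbnd]..|].
by apply/funext => x /=; lra.
Unshelve. all: by end_near. Qed.

Lemma SD_of_approx f : [set: K] !=set0 ->
  (forall delta : R, 0 < delta -> exists s u v : K -> R, [/\ simple_D s,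
    lower_semicontinuous (EFin \o u) /\ (forall x, 0 <= u x <= delta),
    lower_semicontinuous (EFin \o v) /\ (forall x, 0 <= v x <= delta) &
    f \- s = u \- v]) -> SD f.
Proof.
move=> K0 approx.
have /choice[phi phiP] (n : nat) : exists s, simple_D s /\
    (D_norm (f \- s)%R <= (n.+1%:R^-1 + n.+1%:R^-1)%:E)%E.
  have [//|s [u [v [sD [lu uB] [lv vB] fs]]]] := approx n.+1%:R^-1.
  by exists s; split=> //; rewrite fs; exact: D_norm_le.
exists phi; split=> [n|]; first by case: (phiP n).
apply/near_ge0_cvg0eP => [|d d0]; first by apply: nearW => n; exact: D_norm_ge0.
have d2 : 0 < d / 2 by lra.
near=> n; have [_ /le_lt_trans] := phiP n; apply.
rewrite lte_fin.
have : n.+1%:R^-1 < d / 2 by near: n; exact: near_infty_natSinv_lt (PosNum d2).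
by move=> nd; rewrite [ltRHS]splitr; exact: ltrD.
Unshelve. all: by end_near. Qed.

End SD_of_index.

Theorem theorem1p4 (R : realType) (K : metricType R)
    (K_nonempty : [set: K] !=set0) (K_separable : separable_space K)
    (f : K -> R) (f_bounded : bounded_fun f) :
  (SD f ->
     (eps%:E * osc_index f eps)%E @[eps --> (0 : R)^'+] --> (0 : \bar R)%E) /\
  (lower_semicontinuous (EFin \o f) \/ upper_semicontinuous (EFin \o f) ->
     (eps%:E * osc_index f eps)%E @[eps --> (0 : R)^'+] --> (0 : \bar R)%E ->
     SD f).
Proof.
have ge0 : \forall eps \near (0 : R)^'+, (0 <= eps%:E * osc_index f eps)%E.
  near=> eps; apply: mule_ge0; last exact: osc_index_ge0.
  by rewrite lee_fin ltW//; near: eps; exact: nbhs_right_gt.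
split=> [fSD|scf idx]; first by apply/near_ge0_cvg0eP => //; exact: SD_osc_index_lt.
have {}idx : forall d : R, 0 < d ->
    \forall eps \near (0 : R)^'+, (eps%:E * osc_index f eps < d%:E)%E.
  by apply/near_ge0_cvg0eP.
apply: (SD_of_approx _ _ _ K_nonempty) => delta delta0; case: scf => [lf|uf].
  exact: (lsc_simple_approx _ _ _ _ f_bounded lf idx delta0).
(* The upper semicontinuous case passes to [\- f], which has the same index; negating back exchanges
   [u] and [v]. *)
have lf : lower_semicontinuous (EFin \o (\- f)).
  move=> x a; rewrite /= lte_fin ltrNr => fa.
  have [|V xV Vf] := uf x (- a); first by rewrite /= lte_fin.
  by exists V => // y /Vf; rewrite /= !lte_fin ltrNr.
have [|d d0|s [u [v [sD lu lv fs]]]] := lsc_simple_approx _ _ _ delta _ lf _ delta0.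
- have [M fM] := bounded_funP _ _ _ f_bounded; exists M; split; first exact: num_real.
  by move=> t Mt x _ /=; rewrite normrN (le_trans (fM x))// ltW.
- by under eq_near do rewrite osc_index_opp; exact: idx.
exists (\- s), v, u; split=> //; first exact: simple_D_opp.
by apply/funext => x; have /= := congr1 (fun h => h x) fs; lra.
Unshelve. all: by end_near. Qed.
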